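(* If $\Gamma;\Omega;\Delta\vdash M:A\to^kB$ and $x$ is a variable not declared in $\Gamma,\Omega,\Delta$ (hence not free in $M$), then $\Gamma;\Omega;\Delta\vdash\lambda x^k{:}A.\,M\,x^k:A\to^kB$.
   Context: Strict $\lambda$-calculus over a signature $\Sigma$. Labels $k\in\{1,0,u\}$; types $A::=a\mid A_1\to^kA_2$; terms $c\mid x\mid\lambda x^k{:}A.M\mid M_1M_2^k$. $\eta$-expansion at type $A\to^kB$: $M\to\lambda x^k{:}A.\,M\,x^k$. Contexts: finite sets of declarations with distinct variables; commas denote disjoint union. Typing $\Gamma;\Omega;\Delta\vdash M:A$ (unrestricted, irrelevant, strict; disjoint): if $c{:}A\in\Sigma$ then $\Gamma;\Omega;\cdot\vdash c:A$; $(\Gamma,x{:}A);\Omega;\cdot\vdash x:A$; $\Gamma;\Omega;x{:}A\vdash x:A$ (no rule for $\Omega$); from $(\Gamma,x{:}A);\Omega;\Delta\vdash M:B$ infer $\Gamma;\Omega;\Delta\vdash\lambda x^u{:}A.M:A\to^uB$; from $\Gamma;(\Omega,x{:}A);\Delta\vdash M:B$ infer $\Gamma;\Omega;\Delta\vdash\lambda x^0{:}A.M:A\to^0B$; from $\Gamma;\Omega;(\Delta,x{:}A)\vdash M:B$ infer $\Gamma;\Omega;\Delta\vdash\lambda x^1{:}A.M:A\to^1B$; from $\Gamma;\Omega;\Delta\vdash M:A\to^uB$ and $(\Gamma,\Delta);\Omega;\cdot\vdash N:A$ infer $\Gamma;\Omega;\Delta\vdash MN^u:B$; from $\Gamma;\Omega;\Delta\vdash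 M:A\to^0B$ and $(\Gamma,\Omega,\Delta);\cdot;\cdot\vdash N:A$ infer $\Gamma;\Omega;\Delta\vdash MN^0:B$; from $(\Gamma,\Delta_N);\Omega;\Delta_M\vdash M:A\to^1B$ and $(\Gamma,\Delta_M);\Omega;\Delta_N\vdash N:A$ infer $\Gamma;\Omega;(\Delta_M,\Delta_N)\vdash MN^1:B$. *)

(* Defs.v *)
From mathcomp Require Import all_boot finmap.

Set Implicit Arguments.
Unset Strict Implicit.
Unset Printing Implicit Defensive.

Local Open Scope fset_scope.
Local Open Scope fmap_scope.

Inductive label : Type := One | Zero | Unr.

Inductive ty (atom : Type) : Type :=
| Atom (a : atom)
| Arr (k : label) (A B : ty atom).

Notation var := nat.

(* Terms are taken up to renaming of bound variables. They are represented in
   locally nameless style: [Var] carries the name of a free variable, [Bound] a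
   de Bruijn index, and [Abs] binds index 0 of its body. A term in which some
   index is not bound by an [Abs] is never typable ([typing_locally_closed]). *)
Inductive term (atom const : Type) : Type :=
| Const (c : const)
| Var (x : var)
| Bound (i : nat)
| Abs (k : label) (A : ty atom) (M : term atom const)
| App (k : label) (M N : term atom const).

Arguments Atom {atom}.
Arguments Const {atom const}.
Arguments Var {atom const}.
Arguments Bound {atom const}.

Section Terms.
Context {atom const : Type}.
Implicit Types M N : term atom const.

Fixpoint close (i : nat) (x : var) M : term atom const :=
  match M with
  | Const c => Const c
  | Var y => if y == x then Bound i else Var y
  | Bound j => Bound j
  | Abs k A M' => Abs k A (close i.+1 x M')
  | App k M1 M2 => App k (close i x M1) (close i x M2)
  end.

(* The named abstraction [lambda x^k : A. M]. *)
Definition lam (x : var) (k : label) (A : ty atom) M : term atom const :=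
  Abs k A (close 0 x M).

Fixpoint free (x : var) M : bool :=
  match M with
  | Const _ | Bound _ => false
  | Var y => y == x
  | Abs _ _ M' => free x M'
  | App _ M1 M2 => free x M1 || free x M2
  end.

Fixpoint rename (x y : var) M : term atom const :=
  match M with
  | Const c => Const c
  | Var z => Var (if z == x then y else z)
  | Bound j => Bound j
  | Abs k A M' => Abs k A (rename x y M')
  | App k M1 M2 => App k (rename x y M1) (rename x y M2)
  end.

Lemma lam_alpha (x y : var) (k : label) (A : ty atom) M :
  ~~ free y M -> lam x k A M = lam y k A (rename x y M).
Proof.
rewrite /lam => yM; congr Abs; move: 0 yM => i.
elim: M i => //= [z|k' A' M IH|k' M IHM N IHN] i.
- by case: (z =P x) => [_ _|_ /negbTE ->] //; rewrite eqxx.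
- by move=> /IH ->.
- by rewrite negb_or => /andP[/IHM -> /IHN ->].
Qed.

Fixpoint closed_at (n : nat) M : bool :=
  match M with
  | Const _ | Var _ => true
  | Bound i => i < n
  | Abs _ _ M' => closed_at n.+1 M'
  | App _ M1 M2 => closed_at n M1 && closed_at n M2
  end.

Lemma closed_at_close (n : nat) (x : var) M :
  closed_at n M -> closed_at n.+1 (close n x M).
Proof.
elim: M n => //= [y|i|k A M IH|k M IHM N IHN] n.
- by case: ifP => //= _ _; rewrite ltnSn.
- exact: leqW.
- exact: IH.
- by move=> /andP[/IHM -> /IHN ->].
Qed.

End Terms.

Definition ctx (atom : Type) : Type := {fmap var -> ty atom}.

Definition disjoint_ctx {atom : Type} (G D : ctx atom) : bool :=
  [disjoint domf G & domf D]%fset.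

Definition disjoint_ctx3 {atom : Type} (G O D : ctx atom) : bool :=
  [&& disjoint_ctx G O, disjoint_ctx G D & disjoint_ctx O D].

(* [typing Sig G O D M A] is the judgement G; O; D |- M : A, with G the
   unrestricted, O the irrelevant and D the strict declarations. A comma is [+]
   or [.[x <- A]]. Disjointness is only required explicitly where it is not
   already enforced by a premise, see [typing_disjoint]. *)
Inductive typing {atom const : Type} (Sig : const -> option (ty atom)) :
    ctx atom -> ctx atom -> ctx atom -> term atom const -> ty atom -> Prop :=
| typing_const (G O : ctx atom) c A :
    disjoint_ctx G O ->
    Sig c = Some A ->
    typing Sig G O [fmap] (Const c) A
| typing_var_u (G O : ctx atom) x A :
    x \notin domf G -> disjoint_ctx G.[x <- A] O ->
    typing Sig G.[x <- A] O [fmap] (Var x) A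
| typing_var_1 (G O : ctx atom) x A :
    disjoint_ctx3 G O [fmap].[x <- A] ->
    typing Sig G O [fmap].[x <- A] (Var x) A
| typing_lam_u (G O D : ctx atom) x A B M :
    x \notin domf G ->
    typing Sig G.[x <- A] O D M B ->
    typing Sig G O D (lam x Unr A M) (Arr Unr A B)
| typing_lam_0 (G O D : ctx atom) x A B M :
    x \notin domf O ->
    typing Sig G O.[x <- A] D M B ->
    typing Sig G O D (lam x Zero A M) (Arr Zero A B)
| typing_lam_1 (G O D : ctx atom) x A B M :
    x \notin domf D ->
    typing Sig G O D.[x <- A] M B ->
    typing Sig G O D (lam x One A M) (Arr One A B)
| typing_app_u (G O D : ctx atom) A B M N :
    typing Sig G O D M (Arr Unr A B) ->
    typing Sig (G + D) O [fmap] N A ->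
    typing Sig G O D (App Unr M N) B
| typing_app_0 (G O D : ctx atom) A B M N :
    typing Sig G O D M (Arr Zero A B) ->
    typing Sig (G + O + D) [fmap] [fmap] N A ->
    typing Sig G O D (App Zero M N) B
| typing_app_1 (G O DM DN : ctx atom) A B M N :
    disjoint_ctx3 G DM DN ->
    typing Sig (G + DN) O DM M (Arr One A B) ->
    typing Sig (G + DM) O DN N A ->
    typing Sig G O (DM + DN) (App One M N) B.

Section Typing.
Context {atom const : Type} (Sig : const -> option (ty atom)).

Lemma typing_disjoint (G O D : ctx atom) (M : term atom const) (A : ty atom) :
  typing Sig G O D M A -> disjoint_ctx3 G O D.
Proof.
elim=> //= {G O D M A}.
- by move=> G O c A dGO _; rewrite /disjoint_ctx3 dGO /disjoint_ctx !fdisjointX0.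
- by move=> G O x A _ d; rewrite /disjoint_ctx3 d /disjoint_ctx !fdisjointX0.
- move=> G O D x A B M _ _; rewrite /disjoint_ctx3 /disjoint_ctx !dom_setf.
  by rewrite !fdisjointU1X => /and3P[/andP[_ ->] /andP[_ ->] ->].
- move=> G O D x A B M _ _; rewrite /disjoint_ctx3 /disjoint_ctx !dom_setf.
  by rewrite fdisjointXU !fdisjointU1X => /and3P[/andP[_ ->] -> /andP[_ ->]].
- move=> G O D x A B M _ _; rewrite /disjoint_ctx3 /disjoint_ctx !dom_setf.
  by rewrite !fdisjointXU => /and3P[-> /andP[_ ->] /andP[_ ->]].
- move=> G O DM DN A B M N; rewrite /disjoint_ctx3 /disjoint_ctx !domf_cat.
  rewrite !fdisjointXU !fdisjointUX => /and3P[-> -> _] _ /and3P[/andP[-> _] _ ->] _.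
  by move=> /and3P[_ _ ->].
Qed.

Lemma typing_locally_closed (G O D : ctx atom) (M : term atom const) (A : ty atom) :
  typing Sig G O D M A -> closed_at 0 M.
Proof.
elim=> //= {G O D M A}; try by move=> *; apply: closed_at_close.
- by move=> G O D A B M N _ -> _ ->.
- by move=> G O D A B M N _ -> _ ->.
- by move=> G O DM DN A B M N _ _ -> _ ->.
Qed.

End Typing.

(* Main.v *)
Require Import Defs.
From mathcomp Require Import all_boot finmap.

(** The eta-expansion places [M] under one extra unrestricted or irrelevant
    declaration of [x], so the theorem rests on weakening. Weakening alone does
    not go through by induction, because a bound name chosen in the derivation
    may clash with [x]. It is therefore proved together with renaming: a map [f]
    may send the unrestricted and irrelevant contexts into larger ones, and must
    send the strict context bijectively onto its image; under a binder [f] is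
    redirected to a fresh name. *)

Set Implicit Arguments.
Unset Strict Implicit.
Unset Printing Implicit Defensive.

Local Open Scope fset_scope.
Local Open Scope fmap_scope.

(** * Renaming of free names, with fresh names for binders *)

Section Renaming.
Context {atom const : Type}.
Implicit Types (M N : term atom const) (G O D : ctx atom) (f : var -> var).

Fixpoint rename_by f M : term atom const :=
  match M with
  | Const c => Const c
  | Var y => Var (f y)
  | Bound j => Bound j
  | Abs k A M' => Abs k A (rename_by f M')
  | App k M1 M2 => App k (rename_by f M1) (rename_by f M2)
  end.

Lemma rename_by_id M : rename_by id M = M.
Proof. by elim: M => //= [k A M ->|k M -> N ->]. Qed.

Definition redirect f (x z : var) : var -> var :=
  fun y => if y == x then z else f y.

Lemma redirect_same f x z : redirect f x z x = z.
Proof. by rewrite /redirect eqxx. Qed.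

Lemma redirect_neq f x z y : y != x -> redirect f x z y = f y.
Proof. by rewrite /redirect => /negbTE ->. Qed.

Lemma rename_by_close f i x z M :
  (forall y, free y M -> f y != z) ->
  rename_by f (close i x M) = close i z (rename_by (redirect f x z) M).
Proof.
elim: M i => //= [y|k A M IH|k M IHM N IHN] i fz.
- have [->|yx] := eqVneq y x; first by rewrite redirect_same eqxx.
  by rewrite redirect_neq //= (negbTE (fz y _)).
- by rewrite IH.
- by rewrite IHM ?IHN // => y yM; apply: fz; rewrite yM ?orbT.
Qed.

Lemma free_image_finite f M :
  exists s : {fset var}, forall y, free y M -> f y \in s.
Proof.
elim: M => [c|x|i|k A M [s sP]|k M [s sP] N [t tP]] /=.
- by exists fset0.
- by exists [fset f x] => y /eqP <-; rewrite inE.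
- by exists fset0.
- by exists s.
- by exists (s `|` t) => y /orP[/sP|/tP] h; rewrite inE h ?orbT.
Qed.

Lemma exists_fresh (s : {fset nat}) : exists z, z \notin s.
Proof.
exists (\max_(i <- enum_fset s) i).+1; apply/negP => zs.
by have := @leq_bigmax_seq _ (enum_fset s) predT id _ zs isT; rewrite ltnn.
Qed.

(** The abstraction rules speak of [lam], so a renamed abstraction has to be presented again with a
    bound name; [s] will hold the names of the target contexts. The name [z] also avoids the images
    of the free names of [M], which rules out capture. *)
Lemma lam_rename_by f x k A M (s : {fset var}) :
  exists2 z, z \notin s &
    rename_by f (lam x k A M) = lam z k A (rename_by (redirect f x z) M).
Proof.
have [t tP] := free_image_finite f M.
have [z] := exists_fresh (s `|` t); rewrite inE negb_or => /andP[zs zt].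
exists z => //=; rewrite /lam; congr Abs; apply: rename_by_close => y /tP.
by apply: contraTneq => ->.
Qed.

(** * Maps and isomorphisms of contexts *)

Definition ctx_map f G G' : Prop :=
  forall y A, G.[? y] = Some A -> G'.[? f y] = Some A.

(** A strict declaration must be used, so the target may declare nothing outside the image;
    injectivity keeps the two halves of a strict context disjoint after renaming, as [typing_app_1]
    demands. *)
Definition ctx_iso f D D' : Prop :=
  [/\ ctx_map f D D', {in domf D &, injective f} &
      domf D' = f @` domf D].

Lemma ctx_map_dom f G G' y : ctx_map f G G' -> y \in domf G -> f y \in domf G'.
Proof.
move=> fG yG; case E: G.[? y] => [A|]; last by rewrite -fndSome E in yG.
by rewrite -fndSome (fG _ _ E).
Qed.

Lemma ctx_map_redirect f x z G G' :
  x \notin domf G -> ctx_map f G G' -> ctx_map (redirect f x z) G G'.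
Proof.
move=> xG fG y A yA; rewrite redirect_neq; first exact: fG.
by apply: contraNneq xG => <-; rewrite -fndSome yA.
Qed.

Lemma ctx_map_set f x z A G G' :
  z \notin domf G' -> ctx_map f G G' ->
  ctx_map (redirect f x z) G.[x <- A] G'.[z <- A].
Proof.
move=> zG' fG y C; rewrite !fnd_set /redirect; case: eqP => [_|_ yC].
  by rewrite eqxx.
have fyG' := fG _ _ yC; case: eqP => // fyz.
by move: zG'; rewrite -fyz -fndSome fyG'.
Qed.

(** In [+] the right summand has priority, so disjointness of the targets prevents [G2'] from
    overriding an entry that comes from [G1]. *)
Lemma ctx_map_cat f G1 G1' G2 G2' :
  disjoint_ctx G1' G2' -> ctx_map f G1 G1' -> ctx_map f G2 G2' ->
  ctx_map f (G1 + G2) (G1' + G2').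
Proof.
move=> /fdisjointP d f1 f2 y A; rewrite !fnd_cat; case: ifP => [y2|_] yA.
  by rewrite (ctx_map_dom f2 y2); apply: f2.
have fyA := f1 _ _ yA.
by rewrite (negbTE (d _ _)) // -fndSome fyA.
Qed.

Lemma ctx_map_weaken x A G : x \notin domf G -> ctx_map id G G.[x <- A].
Proof.
move=> xG y C yC; rewrite fnd_set; case: eqP => // yx.
by move: xG; rewrite -yx -fndSome yC.
Qed.

Lemma ctx_iso_id D : ctx_iso id D D.
Proof. by split=> //; rewrite imfset_id. Qed.

Lemma ctx_iso_fmap0 f : ctx_iso f ([fmap] : ctx atom) [fmap].
Proof.
split=> [y A|y w|]; first by rewrite fnd_fmap0.
  by rewrite domf0 inE.
by rewrite domf0 imfset0.
Qed.

Lemma ctx_iso_nil f D' : ctx_iso f [fmap] D' -> D' = [fmap].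
Proof.
case=> _ _ dD'; apply/fmapP => y; rewrite fnd_fmap0 not_fnd //.
(* Membership in a finite map is convertible to membership in its domain; the pattern exposes
   [domf D'] to rewriting. *)
by rewrite -[y \in _]/(y \in domf D') dD' imfset0.
Qed.

Lemma ctx_iso_sing f x A D' :
  ctx_iso f [fmap].[x <- A] D' -> D' = [fmap].[f x <- A].
Proof.
case=> fD _ dD'; apply/fmapP => y; rewrite fnd_set fnd_fmap0.
case: eqP => [->|yfx]; first by apply: fD; rewrite fnd_set eqxx.
rewrite not_fnd // -[y \in _]/(y \in domf D') dD' dom_setf.
by rewrite imfsetU1 imfset0 !inE orbF; apply/eqP.
Qed.

Lemma ctx_iso_redirect f x z D D' :
  x \notin domf D -> ctx_iso f D D' -> ctx_iso (redirect f x z) D D'.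
Proof.
move=> xD [fD fI dD'].
have rD : {in domf D, redirect f x z =1 f}.
  by move=> y yD; rewrite redirect_neq //; apply: contraNneq xD => <-.
split; first exact: ctx_map_redirect.
- by move=> y w yD wD; rewrite !rD //; apply: fI.
- by rewrite dD'; apply: eq_in_imfset => // y yD; rewrite rD.
Qed.

Lemma ctx_iso_set f x z A D D' :
  x \notin domf D -> z \notin domf D' -> ctx_iso f D D' ->
  ctx_iso (redirect f x z) D.[x <- A] D'.[z <- A].
Proof.
move=> xD zD' fDD'; have [fD fI dD'] := fDD'.
have [_ rI rD'] := ctx_iso_redirect z xD fDD'.
split; first exact: ctx_map_set.
(* The image of [domf D] is [domf D'], which omits [z], so the new value cannot collide with an old
   one. *)
- have zN y : y \in domf D -> redirect f x z y != z.
    move=> yD; apply: contraNneq zD' => <-.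
    by rewrite rD'; apply: in_imfset.
  move=> y w; rewrite !dom_setf !inE.
  move=> /orP[/eqP->|yD] /orP[/eqP->|wD] //; rewrite ?redirect_same.
  + by move=> zw; move: (zN _ wD); rewrite -zw eqxx.
  + by move=> yz; move: (zN _ yD); rewrite yz eqxx.
  + exact: rI.
- by rewrite !dom_setf imfsetU1 redirect_same rD'.
Qed.

(** A splitting of the source is transported by restricting [D'] to the images of the two halves.
    These cover [D'] because [f] is onto, and are disjoint because [f] is injective. This serves
    strict application, where the target context comes unsplit. *)
Lemma ctx_iso_cat f D1 D2 D' :
  disjoint_ctx D1 D2 -> ctx_iso f (D1 + D2) D' ->
  exists D1' D2', [/\ D' = D1' + D2', disjoint_ctx D1' D2',
    ctx_iso f D1 D1' & ctx_iso f D2 D2'].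
Proof.
move=> d [fD fI dD'].
have sub1 : domf D1 `<=` domf (D1 + D2) by rewrite domf_cat fsubsetUl.
have sub2 : domf D2 `<=` domf (D1 + D2) by rewrite domf_cat fsubsetUr.
have restr (E : ctx atom) : domf E `<=` domf (D1 + D2) ->
    (forall y A, E.[? y] = Some A -> (D1 + D2).[? y] = Some A) ->
    ctx_iso f E D'.[& f @` domf E].
  move=> /fsubsetP sub ext; split.
  - move=> y A yA; have yE : y \in domf E by rewrite -fndSome yA.
    by rewrite fnd_restrict in_imfset //=; apply/fD/ext.
  - by move=> y w yE wE; apply: fI; apply: sub.
  - rewrite domf_restrict dD'; apply/fsetIidPl/fsubsetP => y.
    by move=> /imfsetP[w /= /sub wD ->]; apply: in_imfset.
exists D'.[& f @` domf D1], D'.[& f @` domf D2].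
have iso1 : ctx_iso f D1 D'.[& f @` domf D1].
  apply: restr => // y A yA; rewrite fnd_cat (negbTE (fdisjointP d _ _)) //.
  by rewrite -fndSome yA.
have iso2 : ctx_iso f D2 D'.[& f @` domf D2].
  apply: restr => // y A yA; have y2 : y \in domf D2 by rewrite -fndSome yA.
  by rewrite fnd_cat y2.
split=> //.
- apply/fmapP => y; rewrite fnd_cat.
  have [_ _ e2] := iso2.
  rewrite (congr1 (fun s : {fset var} => y \in s) e2) !fnd_restrict.
  case: ifP => [-> //|y2]; case: ifP => // y1; rewrite not_fnd //.
  by rewrite -[y \in _]/(y \in domf D') dD' domf_cat imfsetU in_fsetU y1 y2.
- have [_ _ e1] := iso1; have [_ _ e2] := iso2.
  apply/fdisjointP => y; rewrite e1 e2 => /imfsetP[v /= v1 ->].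
  (* A common image has preimages [v] in [D1] and [w] in [D2]; injectivity on the whole domain
     identifies them, against [d]. *)
  apply/imfsetP => -[w /= w2 /fI vw].
  have := fdisjointP d _ v1; rewrite vw ?w2 //.
    exact: (fsubsetP sub1).
  exact: (fsubsetP sub2).
Qed.

End Renaming.

(** * Weakening up to renaming *)

Section Weakening.
Context {atom const : Type} (Sig : const -> option (ty atom)).
Implicit Types (M N : term atom const) (G O D : ctx atom) (f : var -> var).

(** The rule [typing_var_u] wants a context that visibly ends in [x]; deleting [x] and declaring it
    again gives that form. *)
Lemma typing_lookup_u G O x A :
  disjoint_ctx G O -> G.[? x] = Some A ->
  typing (const := const) Sig G O [fmap] (Var x) A.
Proof.
move=> d xA; have GE : G = G.[~ x].[x <- A].
  by apply/fmapP => y; rewrite fnd_set fnd_rem1; case: eqP => // ->.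
rewrite GE; apply: typing_var_u; last by rewrite -GE.
by rewrite domf_rem !inE eqxx.
Qed.

Lemma disjoint_ctx3_set G O D z A :
  z \notin domf G `|` domf O `|` domf D -> disjoint_ctx3 G O D ->
  [/\ disjoint_ctx3 G.[z <- A] O D, disjoint_ctx3 G O.[z <- A] D &
      disjoint_ctx3 G O D.[z <- A]].
Proof.
rewrite !inE !negb_or => /andP[/andP[zG zO] zD].
rewrite /disjoint_ctx3 /disjoint_ctx !dom_setf !fdisjointXU !fdisjointU1X.
by rewrite !fdisjointX1 zG zO zD => /and3P[-> -> ->].
Qed.

(** The renaming and the targets are quantified after the derivation, so each binder case can choose
    its own name [z] and apply the induction hypothesis to the redirected map. *)
Lemma typing_rename_weaken G O D M A :
  typing Sig G O D M A -> forall f G' O' D',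
  ctx_map f G G' -> ctx_map f O O' -> ctx_iso f D D' ->
  disjoint_ctx3 G' O' D' ->
  typing Sig G' O' D' (rename_by f M) A.
Proof.
elim=> {G O D M A}.
- move=> G O c A _ cA f G' O' D' fG fO /ctx_iso_nil -> /and3P[d _ _].
  exact: typing_const.
- move=> G O x A _ _ f G' O' D' fG fO /ctx_iso_nil -> /and3P[d _ _].
  by apply: typing_lookup_u => //; apply: fG; rewrite fnd_set eqxx.
- move=> G O x A _ f G' O' D' fG fO /ctx_iso_sing -> d.
  exact: typing_var_1.
- move=> G O D x A B M xG tM IH f G' O' D' fG fO fD d.
  have [z zF ->] := lam_rename_by f x Unr A M (domf G' `|` domf O' `|` domf D').
  have [d' _ _] := disjoint_ctx3_set A zF d.
  (* The premise has disjoint contexts, so the bound name is absent from the other two and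
     redirecting it leaves their maps intact. *)
  have [xO xD] : x \notin domf O /\ x \notin domf D.
    have /and3P[] := typing_disjoint tM.
    by rewrite /disjoint_ctx !dom_setf !fdisjointU1X => /andP[-> _] /andP[-> _].
  move: zF; rewrite !inE !negb_or => /andP[/andP[zG zO] zD].
  apply: typing_lam_u => //; apply: IH => //.
  + exact: ctx_map_set.
  + exact: ctx_map_redirect.
  + exact: ctx_iso_redirect.
- move=> G O D x A B M xO tM IH f G' O' D' fG fO fD d.
  have [z zF ->] := lam_rename_by f x Zero A M (domf G' `|` domf O' `|` domf D').
  have [_ d' _] := disjoint_ctx3_set A zF d.
  have [xG xD] : x \notin domf G /\ x \notin domf D.
    have /and3P[] := typing_disjoint tM.
    rewrite /disjoint_ctx !dom_setf fdisjointXU fdisjointX1 fdisjointU1X.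
    by move=> /andP[-> _] _ /andP[-> _].
  move: zF; rewrite !inE !negb_or => /andP[/andP[zG zO] zD].
  apply: typing_lam_0 => //; apply: IH => //.
  + exact: ctx_map_redirect.
  + exact: ctx_map_set.
  + exact: ctx_iso_redirect.
- move=> G O D x A B M xD tM IH f G' O' D' fG fO fD d.
  have [z zF ->] := lam_rename_by f x One A M (domf G' `|` domf O' `|` domf D').
  have [_ _ d'] := disjoint_ctx3_set A zF d.
  have [xG xO] : x \notin domf G /\ x \notin domf O.
    have /and3P[_] := typing_disjoint tM.
    rewrite /disjoint_ctx !dom_setf !fdisjointXU !fdisjointX1.
    by move=> /andP[-> _] /andP[-> _].
  move: zF; rewrite !inE !negb_or => /andP[/andP[zG zO] zD].
  apply: typing_lam_1 => //; apply: IH => //.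
  + exact: ctx_map_redirect.
  + exact: ctx_map_redirect.
  + exact: ctx_iso_set.
- move=> G O D A B M N _ IHM _ IHN f G' O' D' fG fO fD d.
  (* In the argument the strict names become unrestricted, so the isomorphism is weakened to a plain
     map. *)
  have [fDm _ _] := fD; have := d.
  rewrite /disjoint_ctx3 /disjoint_ctx => /and3P[dGO dGD dOD].
  apply: (typing_app_u (A := A)); first exact: IHM.
  apply: IHN => //.
  + exact: ctx_map_cat.
  + exact: ctx_iso_fmap0.
  + rewrite /disjoint_ctx3 /disjoint_ctx !fdisjointX0 domf_cat fdisjointUX.
    by rewrite dGO fdisjoint_sym dOD.
- move=> G O D A B M N _ IHM _ IHN f G' O' D' fG fO fD d.
  have [fDm _ _] := fD; have := d.
  rewrite /disjoint_ctx3 /disjoint_ctx => /and3P[dGO dGD dOD].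
  apply: (typing_app_0 (A := A)); first exact: IHM.
  apply: IHN => //.
  + apply: ctx_map_cat => //; last exact: ctx_map_cat.
    by rewrite /disjoint_ctx domf_cat fdisjointUX dGD dOD.
  + by have [] := @ctx_iso_fmap0 atom f.
  + exact: ctx_iso_fmap0.
  + by rewrite /disjoint_ctx3 /disjoint_ctx !fdisjointX0.
- move=> G O DM DN A B M N /and3P[_ _ dMN] _ IHM _ IHN f G' O' D' fG fO fD.
  (* Each half stays strict in one premise, as an isomorphism, and turns unrestricted in the other,
     as a plain map. *)
  have [DM' [DN' [-> dMN' fM fN]]] := ctx_iso_cat dMN fD.
  rewrite /disjoint_ctx in dMN'.
  rewrite /disjoint_ctx3 /disjoint_ctx domf_cat !fdisjointXU.
  move=> /and3P[dGO /andP[dGM dGN] /andP[dOM dON]].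
  have [[fMm _ _] [fNm _ _]] := (fM, fN).
  apply: (typing_app_1 (A := A)).
  + by rewrite /disjoint_ctx3 /disjoint_ctx dGM dGN.
  + apply: IHM => //; first exact: ctx_map_cat.
    rewrite /disjoint_ctx3 /disjoint_ctx domf_cat !fdisjointUX dGO dGM dOM.
    by rewrite fdisjoint_sym dON fdisjoint_sym dMN'.
  + apply: IHN => //; first exact: ctx_map_cat.
    rewrite /disjoint_ctx3 /disjoint_ctx domf_cat !fdisjointUX dGO dGN dON.
    by rewrite fdisjoint_sym dOM dMN'.
Qed.

(** This is the case of the identity renaming; freshness of [x] keeps the enlarged contexts
    disjoint. *)
Lemma typing_weaken_u G O D M A x C :
  typing Sig G O D M A -> x \notin domf G `|` domf O `|` domf D ->
  typing Sig G.[x <- C] O D M A.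
Proof.
move=> tM xF; rewrite -(rename_by_id M).
have [d _ _] := disjoint_ctx3_set C xF (typing_disjoint tM).
apply: (typing_rename_weaken tM) => //; last exact: ctx_iso_id.
by apply: ctx_map_weaken; move: xF; rewrite !inE !negb_or => /andP[/andP[]].
Qed.

Lemma typing_weaken_0 G O D M A x C :
  typing Sig G O D M A -> x \notin domf G `|` domf O `|` domf D ->
  typing Sig G O.[x <- C] D M A.
Proof.
move=> tM xF; rewrite -(rename_by_id M).
have [_ d _] := disjoint_ctx3_set C xF (typing_disjoint tM).
apply: (typing_rename_weaken tM) => //; last exact: ctx_iso_id.
by apply: ctx_map_weaken; move: xF; rewrite !inE !negb_or => /andP[/andP[]].
Qed.

End Weakening.

(** * Typing of the eta-expansion *)

Theorem theorem3p6 (atom const : Type) (Sig : const -> option (ty atom))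
    (G O D : ctx atom) (M : term atom const) (k : label) (A B : ty atom) (x : var) :
  typing Sig G O D M (Arr k A B) ->
  x \notin domf G -> x \notin domf O -> x \notin domf D ->
  typing Sig G O D (lam x k A (App k M (Var x))) (Arr k A B).
Proof.
move=> tM xG xO xD.
have xF : x \notin domf G `|` domf O `|` domf D.
  by rewrite !inE !negb_or xG xO xD.
have [dU _ _] := disjoint_ctx3_set A xF (typing_disjoint tM).
(* Strict application needs the extended context written as a sum, with the singleton of [x] as the
   argument's strict part. *)
have catS (E : ctx atom) : E + [fmap].[x <- A] = E.[x <- A].
  by rewrite catf_setr catf0.
case: k tM => tM.
- have := typing_disjoint tM.
  rewrite /disjoint_ctx3 /disjoint_ctx => /and3P[dGO dGD dOD].
  apply: typing_lam_1 => //; rewrite -catS.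
  (* Here [M] keeps [D] strict and sees [x] as unrestricted, while the argument has [x] as its sole
     strict name and sees [D] as unrestricted. *)
  apply: (typing_app_1 (A := A)).
  + rewrite /disjoint_ctx3 /disjoint_ctx dGD dom_setf.
    by rewrite !fdisjointXU !fdisjointX1 xG xD !fdisjointX0.
  + by rewrite catS; apply: typing_weaken_u.
  + apply: typing_var_1; rewrite /disjoint_ctx3 /disjoint_ctx domf_cat dom_setf.
    rewrite !fdisjointXU !fdisjointX1 !fdisjointX0 fdisjointUX dGO.
    by rewrite fdisjoint_sym dOD !inE negb_or xG xD xO.
(* No rule types an irrelevant variable directly, but in an irrelevant argument all declarations
   become unrestricted, so [x] can be looked up there. *)
- apply: typing_lam_0 => //; apply: (typing_app_0 (A := A)).
    exact: typing_weaken_0.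
  apply: typing_lookup_u; first by rewrite /disjoint_ctx fdisjointX0.
  by rewrite !fnd_cat (negbTE xD) fnd_set eqxx dom_setf !inE eqxx.
(* In the unrestricted case [x] is unrestricted in both premises. *)
- move: dU; rewrite /disjoint_ctx3 /disjoint_ctx => /and3P[dGO _ dOD].
  apply: typing_lam_u => //; apply: (typing_app_u (A := A)).
    exact: typing_weaken_u.
  apply: typing_lookup_u.
    by rewrite /disjoint_ctx domf_cat fdisjointUX dGO fdisjoint_sym dOD.
  by rewrite fnd_cat (negbTE xD) fnd_set eqxx.
Qed.
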